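(* For all integers $n$ and $t$ with $n \geq 3$ and $2 \leq 2t < n$, the double generalized Petersen graph $\mathrm{DP}(n,t)$ is Hamiltonian, i.e., it contains a cycle passing through every vertex exactly once.
   Context: Let $\mathbb{Z}_n = \mathbb{Z}/n\mathbb{Z}$. For integers $n \geq 3$ and $t$ with $2 \leq 2t < n$, the double generalized Petersen graph $\mathrm{DP}(n,t)$ is the undirected simple graph with vertex set $V = \{x_i, u_i, v_i, y_i \mid i \in \mathbb{Z}_n\}$ and edge set $E = \{x_ix_{i+1},\ y_iy_{i+1},\ x_iu_i,\ y_iv_i,\ u_iv_{i+t},\ v_iu_{i+t} \mid i \in \mathbb{Z}_n\}$, where indices are taken modulo $n$. *)

(* Defs.v *)
From HB Require Import structures.
From mathcomp Require Import all_boot all_order all_algebra.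

Set Implicit Arguments.
Unset Strict Implicit.
Unset Printing Implicit Defensive.

Import GRing.Theory.

(* 'Z_n is the ring of integers modulo n only for 1 < n (it is Z/2 for
   n = 0, 1); the graph below is intended for 2 < n. *)
Inductive dp_vertex (n : nat) : Type :=
  | X of 'Z_n
  | U of 'Z_n
  | V of 'Z_n
  | Y of 'Z_n.

Arguments X {n} i.
Arguments U {n} i.
Arguments V {n} i.
Arguments Y {n} i.

Section DPVertexFinite.
Variable n : nat.

Definition dp_vertex_code (a : dp_vertex n) : ('Z_n + 'Z_n) + ('Z_n + 'Z_n) :=
  match a with
  | X i => inl (inl i)
  | U i => inl (inr i)
  | V i => inr (inl i)
  | Y i => inr (inr i)
  end.

Definition dp_vertex_decode (c : ('Z_n + 'Z_n) + ('Z_n + 'Z_n)) : dp_vertex n :=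
  match c with
  | inl (inl i) => X i
  | inl (inr i) => U i
  | inr (inl i) => V i
  | inr (inr i) => Y i
  end.

Lemma dp_vertex_codeK : cancel dp_vertex_code dp_vertex_decode.
Proof. by case. Qed.

HB.instance Definition _ := Finite.copy (dp_vertex n) (can_type dp_vertex_codeK).

End DPVertexFinite.

(* The graph is given by its (symmetric, irreflexive) adjacency relation.
   [ucycle e [:: a; b]] holds for any edge ab, hence the length condition. *)
Definition hamiltonian (T : finType) (e : rel T) : Prop :=
  exists c : seq T, [/\ 2 < size c, ucycle e c & forall v : T, v \in c].

Local Open Scope ring_scope.

Definition dp_edges (n t : nat) : {set {set dp_vertex n}} :=
  [set [set X i; X (i + 1)] | i : 'Z_n]
  :|: [set [set Y i; Y (i + 1)] | i : 'Z_n]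
  :|: [set [set X i; U i] | i : 'Z_n]
  :|: [set [set Y i; V i] | i : 'Z_n]
  :|: [set [set U i; V (i + t%:R)] | i : 'Z_n]
  :|: [set [set V i; U (i + t%:R)] | i : 'Z_n].

Definition DP (n t : nat) : rel (dp_vertex n) :=
  fun a b => [set a; b] \in dp_edges n t.

Arguments DP : clear implicits.

Lemma DP_sym (n t : nat) : symmetric (DP n t).
Proof. by move=> a b; rewrite /DP setUC. Qed.

Lemma DP_irr (n t : nat) : irreflexive (DP n t).
Proof.
have D (a b c : dp_vertex n) : b != c -> [set a; a] <> [set b; c].
  by move=> /negP bc /setP E; apply: bc; move: (E b) (E c);
     rewrite !inE !eqxx orbT !orbb => /eqP-> /eqP->.
have S (i : 'Z_n) : i != i + 1 by rewrite -subr_eq0 opprD addNKr oppr_eq0 oner_eq0.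
move=> a; apply/negbTE/negP; rewrite /DP /dp_edges !inE.
case/orP=> [/orP[/orP[/orP[/orP[]|]|]|]|] /imsetP[i _]; apply: D => //;
  by apply/eqP=> -[] /eqP; apply/negP.
Qed.

(* Main.v *)
(** For [n] even, all edges [u_i v_(i+t)] and all spokes, the edges
    [x_i x_(i+1)] with [i] even and the edges [y_(i+t) y_(i+1+t)] with [i] odd
    form a Hamiltonian cycle.

    For [n] odd, let [d = gcd(n, t)] and [m = n / d]. The edges [u_i v_(i+t)]
    and [v_i u_(i+t)] form [d] cycles [C_0, ..., C_(d-1)], where [C_j] contains
    the [u_i] and [v_i] with [i = j mod d]. Cut each [C_j] by removing
    [u_j v_(j+t)] and [u_(j-d) v_(j-d+t)]. For every cyclically consecutive pair
    [C_j], [C_(j+1)], join the new ends by an outer path in the x-cycle and its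
    translate by [t] in the y-cycle: these paths have ends [j, j+1] for [j] even
    and [j-d, j+1-d] for [j] odd, except that for [j = d-1] they run from [d-1]
    to [n-d]. The outer paths cover all of the x- and y-cycles. Since [d] is odd,
    going twice around the residues modulo [d], alternately following arcs
    forwards and backwards, traverses everything in one closed walk. *)

Require Import Defs.
From mathcomp Require Import all_boot all_order all_algebra.
From mathcomp Require Import zify.

Set Implicit Arguments.
Unset Strict Implicit.
Unset Printing Implicit Defensive.

(** * Walks glued from blocks *)

Lemma size_flatten_mkseq (T : Type) (F : nat -> seq T) N :
  size (flatten (mkseq F N)) = \sum_(0 <= s < N) size (F s).
Proof. by rewrite size_flatten sumnE /shape !big_map /index_iota subn0. Qed.

Lemma flatten_mkseq_mem (T : eqType) (F : nat -> seq T) N s x :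
  s < N -> x \in F s -> x \in flatten (mkseq F N).
Proof.
move=> sN xF; apply/flattenP; exists (F s) => //.
by apply/mapP; exists s => //; rewrite mem_iota.
Qed.

Section Walk.
Variables (T : finType) (e : rel T).

Definition walk (a b : T) (s : seq T) : bool :=
  if s is x :: s' then [&& x == a, path e x s' & last x s' == b] else false.

Lemma walk_cat a b b' c s1 s2 :
  walk a b s1 -> e b b' -> walk b' c s2 -> walk a c (s1 ++ s2).
Proof.
case: s1 => //= x s1 /and3P[-> p1 /eqP l1]; case: s2 => //= y s2 ebb.
by case/and3P=> /eqP-> p2 l2; rewrite cat_path last_cat /= l1 p1 ebb p2.
Qed.

Lemma walk_rev a b s : symmetric e -> walk a b s -> walk b a (rev s).
Proof.
move=> e_sym; case: s => //= x s /and3P[/eqP-> p /eqP l].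
have := rev_path e a s; rewrite l (eq_path (e' := e)) => [E|? ?]; last exact: e_sym.
rewrite lastI l rev_rcons /= eqxx E p /=.
case: s l {p E} => [<- | y s _]; first by rewrite /= eqxx.
by rewrite [belast _ _]/= rev_cons last_rcons.
Qed.

Lemma walk_mkseq (f : nat -> T) l a b :
    f 0 = a -> f l = b -> (forall i, e (f i) (f i.+1)) ->
  walk a b (mkseq f l.+1).
Proof.
move=> fa fb ef; rewrite /= fa eqxx /=.
have E i k : path e (f i) (map f (iota i.+1 k)) &&
  (last (f i) (map f (iota i.+1 k)) == f (i + k)).
  elim: k i => [|k IH] i /=; first by rewrite addn0 eqxx.
  by rewrite ef addnS -addSn IH.
by rewrite -fa -fb; apply: E.
Qed.

Lemma walk_flatten (F : nat -> seq T) (a b : nat -> T) N :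
    (forall s, s < N.+1 -> walk (a s) (b s) (F s)) ->
    (forall s, s < N -> e (b s) (a s.+1)) ->
  walk (a 0) (b N) (flatten (mkseq F N.+1)).
Proof.
elim: N => [|N IH] wF eF; first by rewrite /= cats0 wF.
rewrite mkseqS flatten_rcons.
apply: (walk_cat (b := b N) (b' := a N.+1)); last exact: wF.
  by apply: IH => s h; [apply: wF | apply: eF]; rewrite ltnW.
exact: eF.
Qed.

(** A covering list with at most [#|T|] entries cannot repeat a vertex, so coverage and length are
    checked instead of distinctness. *)
Lemma hamiltonian_closed_walk a b s :
    walk a b s -> e b a -> 2 < #|T| -> size s <= #|T| -> (forall x, x \in s) ->
  hamiltonian e.
Proof.
move=> w eba T3 sT sA; exists s.
have us : uniq s.
  apply: (leq_size_uniq (enum_uniq T)) => [x _|]; first exact: sA.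
  by rewrite -cardE.
split=> //.
  by apply: leq_trans T3 _; rewrite cardE; apply: uniq_leq_size (enum_uniq T) _.
rewrite /ucycle us andbT; case: s w {sT sA us} => //= x s.
by case/and3P=> /eqP-> p /eqP l; rewrite rcons_path p l.
Qed.

End Walk.

(** * Indices modulo [n] and the edges of the graph *)

Section DoubleGeneralizedPetersen.
Variables (n t : nat).
Hypothesis n_gt2 : 2 < n.

Local Notation "k %:N" := ((k%:R)%R : 'Z_n) (at level 1, format "k %:N").
Local Notation e := (DP n t).

(** Multiples of [n] on both sides avoid truncated subtraction: congruences become identities in
    [nat]. *)
Lemma natZ_eq (a b x y : nat) : a + x * n = b + y * n -> a%:N = b%:N.
Proof.
move=> E; rewrite -[LHS]Zp_nat_mod; last lia.
by rewrite -(modnMDl x) addnC E addnC modnMDl Zp_nat_mod //; lia.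
Qed.

Lemma natZ_repr (i : 'Z_n) : exists2 k, k < n & i = k%:N.
Proof.
exists i; last by rewrite natr_Zp.
by case: i => k /=; rewrite Zp_cast //; lia.
Qed.

Lemma card_dp_vertex : #|{: dp_vertex n}| = 4 * n.
Proof.
rewrite (bij_eq_card (f := @dp_vertex_code n)).
  by rewrite !card_sum card_ord Zp_cast; lia.
exists (@dp_vertex_decode n); first exact: dp_vertex_codeK.
by move=> [[]|[]].
Qed.

Lemma DP_XX k : e (X k%:N) (X k.+1%:N).
Proof. by rewrite /DP !inE -GRing.natr1 (imset_f (fun i => [set X i; X (i + 1)%R])). Qed.

Lemma DP_YY k : e (Y k%:N) (Y k.+1%:N).
Proof.
by rewrite /DP !inE -GRing.natr1 (imset_f (fun i => [set Y i; Y (i + 1)%R])) ?orbT.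
Qed.

Lemma DP_XU (i : 'Z_n) : e (X i) (U i).
Proof. by rewrite /DP !inE (imset_f (fun i => [set X i; U i])) ?orbT. Qed.

Lemma DP_YV (i : 'Z_n) : e (Y i) (V i).
Proof. by rewrite /DP !inE (imset_f (fun i => [set Y i; V i])) ?orbT. Qed.

Lemma DP_UV k : e (U k%:N) (V (k + t)%:N).
Proof.
by rewrite /DP !inE GRing.natrD (imset_f (fun i => [set U i; V (i + t%:R)%R])) ?orbT.
Qed.

Lemma DP_VU k : e (V k%:N) (U (k + t)%:N).
Proof.
by rewrite /DP !inE GRing.natrD (imset_f (fun i => [set V i; U (i + t%:R)%R])) ?orbT.
Qed.

Lemma DP_UX (i : 'Z_n) : e (U i) (X i).
Proof. by rewrite DP_sym DP_XU. Qed.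

Lemma DP_VY (i : 'Z_n) : e (V i) (Y i).
Proof. by rewrite DP_sym DP_YV. Qed.

(** * The case of even [n] *)

Definition even_block s : seq (dp_vertex n) :=
  let i := 2 * s in
  [:: X i%:N; X i.+1%:N; U i.+1%:N; V (i.+1 + t)%:N;
      Y (i.+1 + t)%:N; Y (i.+1 + t).+1%:N; V (i.+2 + t)%:N; U i.+2%:N].

(** Block [s] ends at u_(2s+2), adjacent to the first vertex x_(2s+2) of the next block; the last
    block closes up because 2N+2 = n. *)
Lemma hamiltonian_even : ~~ odd n -> hamiltonian e.
Proof.
move=> n_even.
have [N nE] : exists N, n = 2 * N.+1 by exists (n./2.-1); lia.
apply: (hamiltonian_closed_walk (a := X (2 * 0)%:N) (b := U (2 * N).+2%:N)
  (s := flatten (mkseq even_block N.+1))).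
- apply: (walk_flatten (a := fun s => X (2 * s)%:N) (b := fun s => U (2 * s).+2%:N)).
    move=> s _ /=; rewrite !eqxx DP_XX DP_XU DP_UV DP_VY DP_YY DP_YV.
    by rewrite DP_sym DP_UV.
  by move=> s _; rewrite (_ : 2 * s.+1 = (2 * s).+2) ?DP_UX //; lia.
- by rewrite (natZ_eq (b := 2 * 0) (x := 0) (y := 1)) ?DP_UX //; lia.
- by rewrite card_dp_vertex; lia.
- by rewrite card_dp_vertex size_flatten_mkseq (eq_bigr (fun=> 8)) // sum_nat_const_nat; lia.
(* Block [s] meets each kind of vertex at the indices 2s+c and 2s+c+1, with c = 0 for [X], 1 for
   [U], t+1 for [V] and [Y]. Below, [r] is k-c modulo n; the summand [c * n] prevents truncation. *)
have cover k c : exists2 s, s < N.+1 &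
    k%:N = (2 * s + c)%:N \/ k%:N = (2 * s + c).+1%:N.
  pose r := (k + c * n - c) %% n.
  have r_lt : r < n by apply: ltn_pmod; lia.
  have rE : k + c * n = (k + c * n - c) %/ n * n + r + c.
    by rewrite -divn_eq subnK //; nia.
  exists r./2; first lia.
  case r_odd: (odd r); [right | left].
    by apply: (natZ_eq (x := c) (y := (k + c * n - c) %/ n)); lia.
  by apply: (natZ_eq (x := c) (y := (k + c * n - c) %/ n)); lia.
case=> i; have [k _ ->] := natZ_repr i.
- have [s sN] := cover k 0; rewrite addn0.
  by case=> ->; apply: (flatten_mkseq_mem sN); rewrite !inE !eqxx ?orbT.
- have [s sN] := cover k 1; rewrite addn1.
  by case=> ->; apply: (flatten_mkseq_mem sN); rewrite !inE !eqxx ?orbT.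
- have [s sN] := cover k t.+1; rewrite addnS -addSn.
  by case=> ->; apply: (flatten_mkseq_mem sN); rewrite !inE !eqxx ?orbT.
- have [s sN] := cover k t.+1; rewrite addnS -addSn.
  by case=> ->; apply: (flatten_mkseq_mem sN); rewrite !inE !eqxx ?orbT.
Qed.

(** * The case of odd [n] *)

Section Odd.
Variables d' m K h t' : nat.
Let d := d'.+1.
Hypotheses (d_odd : odd d) (m_odd : odd m) (m_gt1 : 1 < m).
Hypotheses (nE : n = d * m) (tE : t = d * t').
Hypotheses (K_even : ~~ odd K) (K_gt0 : 0 < K) (K_lt : K < 2 * m).
Hypothesis KtE : K * t = d + h * n.

Definition inner_vertex (b : bool) (k : nat) : dp_vertex n :=
  if b then U k%:N else V k%:N.

Definition inner (a l : nat) : seq (dp_vertex n) :=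
  mkseq (fun k => inner_vertex (odd k) (a + k * t)) l.

Definition segment (Z : 'Z_n -> dp_vertex n) (a l : nat) : seq (dp_vertex n) :=
  mkseq (fun k => Z (a + k)%:N) l.+1.

(** After [m] steps of size [t] the index returns, but on the other side since [m] is odd; hence C_j
    has length 2m. *)
Lemma mt_eq : m * t = t' * n.
Proof. by rewrite nE tE; nia. Qed.

Lemma d_double_le : 2 * d <= n.
Proof. by rewrite nE; nia. Qed.

Lemma walk_inner a b l : ~~ odd l -> 0 < l -> (a + l.-1 * t)%:N = b%:N ->
  walk e (V a%:N) (U b%:N) (inner a l).
Proof.
case: l => // l /=; rewrite negbK => l_odd _ <-.
apply: walk_mkseq => [||k] /=; rewrite ?addn0 // /inner_vertex ?l_odd //.
have -> : a + k.+1 * t = a + k * t + t by lia.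
by case: (odd k) => /=; [apply: DP_UV | apply: DP_VU].
Qed.

Lemma walk_segment_X a b l : a + l = b -> walk e (X a%:N) (X b%:N) (segment X a l).
Proof.
by move=> <-; apply: walk_mkseq => [||k]; rewrite ?addn0 ?addnS //; apply: DP_XX.
Qed.

Lemma walk_segment_Y a b l : a + l = b -> walk e (Y a%:N) (Y b%:N) (segment Y a l).
Proof.
by move=> <-; apply: walk_mkseq => [||k]; rewrite ?addn0 ?addnS //; apply: DP_YY.
Qed.

(* [K * t = d] modulo [n], so [arc j] leads from [v_(j-d+t)] to [u_j], and
   [coarc j] from [v_(j+t)] to [u_(j-d)]; here [j - d] is encoded as [n - d + j]. *)
Definition arc j := inner (n - d + j + t) K.
Definition coarc j := inner (j + t) (2 * m - K).

Lemma walk_arc j : walk e (V (n - d + j + t)%:N) (U j%:N) (arc j).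
Proof.
apply: walk_inner => //; apply: (natZ_eq (x := 0) (y := h.+1)).
have : t + K.-1 * t = d + h * n by rewrite -KtE; case: (K) K_gt0 => // k _; lia.
by have := d_double_le; lia.
Qed.

Lemma walk_coarc j : walk e (V (j + t)%:N) (U (n - d + j)%:N) (coarc j).
Proof.
apply: walk_inner; [lia | lia |].
apply: (natZ_eq (x := h.+1) (y := 2 * t')).
have /(congr1 (muln^~ t)) : (2 * m - K).-1.+1 + K = 2 * m by lia.
rewrite mulnDl mulSn -mulnA.
by rewrite mt_eq KtE; have := d_double_le; lia.
Qed.

(** Going along C_j from v_(j+t), the first 2m-K vertices form [coarc j] and the other K form
    [arc j]. The given vertex has position c-1 modulo 2m, called [r]. *)
Lemma arc_coarc_mem j c :
  inner_vertex (~~ odd c) (j + c * t) \in arc j ++ coarc j.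
Proof.
pose r := (c + (2 * m).-1) %% (2 * m); pose q := (c + (2 * m).-1) %/ (2 * m).
have rE : c + 2 * m = q * (2 * m) + r.+1.
  by have := divn_eq (c + (2 * m).-1) (2 * m); rewrite -/q -/r; lia.
have r_lt : r < 2 * m by apply: ltn_pmod; lia.
have r_odd : ~~ odd c = odd r by lia.
have rtE : c * t + 2 * t' * n = q * 2 * t' * n + r * t + t.
  by have := congr1 (muln^~ t) rE; rewrite !mulnDl -!mulnA mt_eq mulSn; lia.
rewrite mem_cat r_odd; apply/orP.
have [rK | Kr] := ltnP r (2 * m - K).
  right; apply/mapP; exists r; first by rewrite mem_iota.
  rewrite /inner_vertex; have -> // : (j + c * t)%:N = (j + t + r * t)%:N.
  by apply: (natZ_eq (x := 2 * t') (y := q * 2 * t')); lia.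
have [i iE] : exists i, i + 2 * m = r + K by exists (r + K - 2 * m); lia.
left; apply/mapP; exists i; first by rewrite mem_iota; lia.
have -> : odd i = odd r by move: K_even iE; clear; lia.
rewrite /inner_vertex; have -> // : (j + c * t)%:N = (n - d + j + t + i * t)%:N.
apply: (natZ_eq (x := 1 + h + 4 * t') (y := q * 2 * t' + 4 * t')).
have := congr1 (muln^~ t) iE; rewrite !mulnDl -mulnA.
by rewrite mt_eq KtE; have := d_double_le; lia.
Qed.

(* The number of edges of the [j]-th outer segment; the last one absorbs the
   slack [n - 2 * d]. *)
Definition seglen j := if j == d' then (n - 2 * d).+1 else 1.

(** First turn around the residues, using the arcs. *)
Definition low_block j :=
  if odd j then rev (arc j) ++ segment Y (n - d + j + t) (seglen j)
  else arc j ++ segment X j (seglen j).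

(** Second turn, using the coarcs. As [d] is odd, the roles of the parities are exchanged, so each
    [j] now gets the outer path that the first turn left out. *)
Definition high_block j :=
  if odd j then coarc j ++ segment X (n - d + j) (seglen j)
  else rev (coarc j) ++ segment Y (j + t) (seglen j).

Lemma walk_low : walk e (V (n - d + 0 + t)%:N) (X (n - d)%:N)
  (flatten (mkseq low_block d)).
Proof.
pose a j := if odd j then U j%:N else V (n - d + j + t)%:N.
pose b j := if odd j then Y (n - d + j + t + seglen j)%:N else X (j + seglen j)%:N.
(* [d'] is even, so the last outer path lies in the x-cycle, from d-1 to n-d. *)
have -> : X (n - d)%:N = b d'.
  rewrite /b /seglen eqxx ifN; last by move: d_odd; rewrite /d /=.
  by rewrite (_ : n - d = d' + (n - 2 * d).+1) //; have := d_double_le; lia.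
apply: (walk_flatten (a := a)) => j jd.
  rewrite /a /b /low_block; case: ifP => _.
    apply: (walk_cat (walk_rev (@DP_sym n t) (walk_arc j)) (DP_VY _)).
    exact: walk_segment_Y.
  exact: (walk_cat (walk_arc j) (DP_UX _) (walk_segment_X _)).
rewrite /a /b /seglen ltn_eqF //= ; case: (odd j) => /=.
  by rewrite (_ : n - d + j + t + 1 = n - d + j.+1 + t) ?DP_YV //; lia.
by rewrite addn1 DP_XU.
Qed.

Lemma walk_high : walk e (U (n - d + 0)%:N) (Y (n - d + t)%:N)
  (flatten (mkseq high_block d)).
Proof.
pose a j := if odd j then V (j + t)%:N else U (n - d + j)%:N.
pose b j := if odd j then X (n - d + j + seglen j)%:N else Y (j + t + seglen j)%:N.
have -> : Y (n - d + t)%:N = b d'.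
  rewrite /b /seglen eqxx ifN; last by move: d_odd; rewrite /d /=.
  by rewrite (_ : n - d + t = d' + t + (n - 2 * d).+1) //; have := d_double_le; lia.
apply: (walk_flatten (a := a)) => j jd.
  rewrite /a /b /high_block; case: ifP => _.
    exact: (walk_cat (walk_coarc j) (DP_UX _) (walk_segment_X _)).
  apply: (walk_cat (walk_rev (@DP_sym n t) (walk_coarc j)) (DP_VY _)).
  exact: walk_segment_Y.
rewrite /a /b /seglen ltn_eqF //= ; case: (odd j) => /=.
  by rewrite addn1 addnS DP_XU.
by rewrite (_ : j + t + 1 = j.+1 + t) ?DP_YV //; lia.
Qed.

(** Even j < d' cover the indices below d', j = d' covers those from d' to n-d, and odd j cover the
    rest. *)
Lemma segment_cover k : k < n -> exists j i, [/\ j < d, i < (seglen j).+1 &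
  k = if odd j then n - d + j + i else j + i].
Proof.
move=> k_lt; have dn := d_double_le; rewrite /seglen.
have d'_even : ~~ odd d' by move: d_odd; rewrite /d /=.
have [k_lo | k_hi] := ltnP k d'.
  exists (k - odd k), (odd k); split; [lia | by case: ifP; lia | case: ifP; lia].
have [k_mid | k_top] := leqP k (n - d).
  by exists d', (k - d'); rewrite eqxx (negbTE d'_even); split; lia.
pose r := k - (n - d).
exists (r - ~~ odd r), (~~ odd r); split; [lia | case: ifP; lia | case: ifP; lia].
Qed.

Lemma segment_mem Z a l i : i < l.+1 -> Z (a + i)%:N \in segment Z a l.
Proof. by move=> il; apply/mapP; exists i => //; rewrite mem_iota. Qed.

Lemma hamiltonian_odd : hamiltonian e.
Proof.
have dn := d_double_le.
apply: (hamiltonian_closed_walk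
  (walk_cat walk_low _ walk_high)); rewrite ?addn0 ?card_dp_vertex.
- by rewrite DP_XU.
- by rewrite DP_YV.
- lia.
- rewrite size_cat !size_flatten_mkseq -big_split /=.
  (* For each [j], arc and coarc have 2m vertices together and the two outer paths [seglen j + 1]
     each; the sum is exactly 4n. *)
  rewrite (eq_bigr (fun j => 2 * m + 2 + 2 * seglen j)) => [|j _]; last first.
    rewrite /low_block /high_block.
    by case: ifP => _; rewrite !size_cat ?size_rev !size_mkseq; lia.
  rewrite big_nat_recr //= {2}/seglen eqxx.
  rewrite (eq_big_nat _ _ (F2 := fun=> 2 * m + 4)) => [|j /andP[_ jd]]; last first.
    by rewrite /seglen ltn_eqF //; lia.
  have nE' : n = d' * m + m by rewrite nE mulSn addnC.
  by rewrite sum_nat_const_nat subn0 mulnDr; lia.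
have block_mem x j : j < d -> (x \in low_block j) || (x \in high_block j) ->
    x \in flatten (mkseq low_block d) ++ flatten (mkseq high_block d).
  move=> jd; rewrite mem_cat => /orP[] xj; apply/orP; [left | right];
  exact: (flatten_mkseq_mem jd xj).
have inner_mem x k (b : bool) : k < n -> x = inner_vertex b k ->
    x \in flatten (mkseq low_block d) ++ flatten (mkseq high_block d).
  move=> k_lt ->; pose j := k %% d; pose q := k %/ d.
  have kE : k = q * d + j by apply: divn_eq.
  apply: (block_mem _ j); first exact: ltn_pmod.
  (* [q * K] steps shift the index by q*d and keep the side, as [K] is even; [m] further steps
     switch the side at the same index. *)
  pose c := q * K + ~~ b * m.
  have -> : inner_vertex b k = inner_vertex (~~ odd c) (j + c * t).
    have -> : ~~ odd c = b.
      by rewrite oddD !oddM (negbTE K_even) m_odd andbF andbT oddb negbK.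
    rewrite /inner_vertex; have -> // : k%:N = (j + c * t)%:N.
    apply: (natZ_eq (x := q * h + ~~ b * t') (y := 0)).
    have : c * t = q * (K * t) + ~~ b * (m * t) by rewrite /c; lia.
    by rewrite mt_eq KtE; lia.
  have := arc_coarc_mem j c; rewrite mem_cat /low_block /high_block.
  by case: ifP => _; rewrite !mem_cat ?mem_rev => /orP[->|->]; rewrite ?orbT.
case=> i; have [k k_lt ->] := natZ_repr i.
- have [j [l [jd ll ->]]] := segment_cover k_lt.
  apply: (block_mem _ j jd); rewrite /low_block /high_block.
  by case: ifP => _; rewrite !mem_cat segment_mem ?orbT.
- exact: (inner_mem _ k true).
- exact: (inner_mem _ k false).
(* The outer paths in the y-cycle are translates by [t], so the cover is applied to k-t modulo n. *)
pose k' := (k + t * n - t) %% n.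
have k'_lt : k' < n by apply: ltn_pmod; lia.
have -> : k%:N = (k' + t)%:N.
  apply: (natZ_eq (x := t) (y := (k + t * n - t) %/ n)).
  have t_le : t <= t * n by rewrite leq_pmulr //; lia.
  by have := divn_eq (k + t * n - t) n; rewrite -/k'; lia.
have [j [l [jd ll ->]]] := segment_cover k'_lt.
apply: (block_mem _ j jd); rewrite /low_block /high_block.
by case: ifP => _; rewrite !mem_cat addnAC segment_mem ?orbT.
Qed.

End Odd.

End DoubleGeneralizedPetersen.

(** Since [m] is odd, 2t is invertible modulo [m]; so [t] has an even inverse 2r, as needed for an
    arc from a [V] to a [U]. *)
Lemma coprime_even_inverse m t : odd m -> 1 < m -> 0 < t -> coprime t m ->
  exists r h, 0 < r < m /\ 2 * r * t = h * m + 1.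
Proof.
move=> m_odd m_gt1 t_gt0 co.
have /eqP g1 : coprime (2 * t) m by rewrite coprimeMl coprime2n m_odd.
have tt_gt0 : 0 < 2 * t by lia.
case: (egcdnP m tt_gt0) => r h; rewrite g1 muln1 => E h_lt.
exists r, h; split; last by rewrite -E mulnCA mulnA.
have r_gt0 : 0 < r by case: r E => //; lia.
(* The Bézout bound h < 2t gives 2rt = hm+1 < (h+1)m <= 2tm, hence r < m. *)
rewrite r_gt0 -(ltn_pmul2r tt_gt0) E.
have := leq_mul h_lt (leqnn m); rewrite mulSn; lia.
Qed.

Theorem theorem1 (n t : nat) (hn : 3 <= n) (ht : 2 <= 2 * t < n) :
  hamiltonian (DP n t).
Proof.
have [n_odd | n_even] := boolP (odd n); last exact: hamiltonian_even.
have d_gt0 : 0 < gcdn n t by rewrite gcdn_gt0; lia.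
have [m nE] := dvdnP (dvdn_gcdl n t); have [t' tE] := dvdnP (dvdn_gcdr n t).
have co : coprime t' m.
  by rewrite /coprime gcdnC -(eqn_pmul2r d_gt0) mul1n muln_gcdl -nE -tE.
move: (gcdn n t) d_gt0 nE tE => d d_gt0 nE tE.
have t'_gt0 : 0 < t' by case: t' tE {co} => //; lia.
have m_gt1 : 1 < m.
  rewrite -(ltn_pmul2r d_gt0) -nE mul1n.
  have : d <= t by rewrite tE leq_pmull.
  lia.
have /andP[m_odd d_odd] : odd m && odd d by rewrite -oddM -nE.
have [r [h [/andP[r_gt0 r_lt] rE]]] := coprime_even_inverse m_odd m_gt1 t'_gt0 co.
case: d d_gt0 nE tE d_odd => // d _ nE tE d_odd.
(* With K = 2r, multiplying 2rt' = hm+1 by gcd(n, t) gives [KtE]. *)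
apply: (@hamiltonian_odd n t hn d m (2 * r) h t') => //; try lia.
by rewrite tE nE mulnA rE; lia.
Qed.
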